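(* Let $\theta>0$, let $n\ge 2$ and let $a_j\in\mathbf{R}$, $1\le j\le n$, be arbitrary. Let $\xi_1,\dots,\xi_n$ be mutually independent Poisson random variables with $\mathbf{E}\xi_j=\theta/j$, and set $Y_n=a_1\xi_1+\cdots+a_n\xi_n$ and $\ell(\bar\xi)=1\xi_1+2\xi_2+\cdots+n\xi_n$. Then $$\mathrm{Var}\big(Y_n\,\big|\,\ell(\bar\xi)=n\big)\le\frac{\theta(\theta+2)}{\theta+1}\sum_{j=1}^n\frac{a_j^2}{j}\,\frac{\Theta(n-j)}{\Theta(n)}.$$
   Context: For $m\in\{0,1,2,\dots\}$, $(x)_m=x(x+1)\cdots(x+m-1)$ (with $(x)_0=1$) and $\Theta(m)=(\theta)_m/m!$. The conditional variance $\mathrm{Var}(Y_n\mid \ell(\bar\xi)=n)$ is the variance of $Y_n$ under the conditional probability measure given the event $\{\ell(\bar\xi)=n\}$ (which has positive probability). *)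

(* Defs.v *)
From HB Require Import structures.
From mathcomp Require Import all_boot all_order all_algebra.
From mathcomp Require Import all_classical all_reals all_analysis.

Set Implicit Arguments.
Unset Strict Implicit.
Unset Printing Implicit Defensive.

Import Order.TTheory GRing.Theory Num.Theory.
Import numFieldNormedType.Exports.

Local Open Scope classical_set_scope.
Local Open Scope ring_scope.

Definition rising_factorial (R : realType) (x : R) (m : nat) : R :=
  \prod_(k < m) (x + k%:R).

Definition Theta (R : realType) (theta : R) (m : nat) : R :=
  rising_factorial theta m / m`!%:R.

(* The natural number argument of [poisson_prob] is unused by its definition. *)
Definition poisson_distributed d (T : measurableType d) (R : realType)
    (P : probability T R) (rate : R) (X : {RV P >-> nat}) : Prop :=
  distribution P X = poisson_prob rate 0 :> (set nat -> \bar R).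

Definition mutually_independent d d' (T : measurableType d)
    (T' : measurableType d') (R : realType) (P : probability T R)
    (I : finType) (X : I -> {RV P >-> T'}) : Prop :=
  forall (J : {set I}) (B : I -> set T'), (forall i, measurable (B i)) ->
    P (\bigcap_(i in [set` J]) (X i @^-1` B i)) =
    (\prod_(i in J) P (X i @^-1` B i))%E.

Arguments poisson_distributed {d T R} P rate X.
Arguments mutually_independent {d d' T T' R} P {I} X.

(* The last argument of [mnormalize] is only a default value for events of
   probability zero; see [cond_probE]. *)
Definition cond_prob d (T : measurableType d) (R : realType)
    (P : probability T R) (A : set T) (mA : measurable A) : probability T R :=
  mnormalize (mrestr P mA) P.

Lemma cond_probE d (T : measurableType d) (R : realType)
    (P : probability T R) (A : set T) (mA : measurable A) (U : set T) :
  (0 < P A)%E -> cond_prob P mA U = (P (U `&` A) * (fine (P A))^-1%:E)%E.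
Proof.
have E : mrestr P mA setT = P A by rewrite /mrestr setTI.
move=> PA; rewrite /cond_prob/= /mnormalize /= E gt_eqF//=.
by rewrite lt_eqF// ltey_eq fin_num_measure.
Qed.

(* [i : 'I_n] stands for the index [j = i.+1] in {1, ..., n}. *)
Definition ell d (T : measurableType d) (n : nat)
    (xi : 'I_n -> {mfun T >-> nat}) (w : T) : nat :=
  (\sum_(i < n) i.+1 * xi i w)%N.

Definition lin_stat d (T : measurableType d) (R : realType) (n : nat)
    (a : 'I_n -> R) (xi : 'I_n -> {mfun T >-> nat}) (w : T) : R :=
  \sum_(i < n) a i * (xi i w)%:R.

Lemma measurable_ell d (T : measurableType d) (n : nat)
    (xi : 'I_n -> {mfun T >-> nat}) :
  measurable_fun setT (ell xi).
Proof.
have H (s : seq 'I_n) :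
    measurable_fun setT (fun w => \sum_(i <- s) i.+1 * xi i w)%N.
  elim: s => [|i s IHs].
    by under eq_fun do rewrite big_nil; exact: measurable_cst.
  under eq_fun do rewrite big_cons.
  have mxi : measurable_fun setT (fun w => i.+1 * xi i w)%N.
    exact: (measurableT_comp (f := fun k => (i.+1 * k)%N)).
  move=> _ Y _; rewrite setTI.
  rewrite [X in measurable X](_ : _ = \bigcup_k
    ((fun w => i.+1 * xi i w)%N @^-1` [set k] `&`
     (fun w => \sum_(j <- s) j.+1 * xi j w)%N @^-1` [set m | Y (k + m)%N])).
    apply: bigcup_measurable => k _; apply: measurableI.
      by rewrite -[X in measurable X]setTI; exact: mxi.
    by rewrite -[X in measurable X]setTI; exact: IHs.
  apply/seteqP; split => [w Yw|w [k _ [/= <-]]//].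
  by exists (i.+1 * xi i w)%N.
exact: H.
Qed.

Lemma measurable_ell_eq d (T : measurableType d) (n : nat)
    (xi : 'I_n -> {mfun T >-> nat}) (m : nat) :
  measurable (ell xi @^-1` [set m]).
Proof.
by rewrite -[X in measurable X]setTI; exact: (measurable_ell xi).
Qed.

(* Main.v *)
(** Conditionally on ell = n the vector xi lives on finitely many
configurations c, with weights prod_j (theta/j)^(c_j) / c_j! normalised by
Theta(n).  Removing one part of size j turns c_j into the factor theta/j and n
into n - j, so the first two moments of Y_n are explicit, and
  Theta(n) Var = theta (D(a,a) + B(a,a)),
where D(a,a) = sum_j a_j^2 Theta(n-j)/j and B is the D-symmetric form of the
operator K a (j) = E_(n-j) Y - E_n Y.  On the falling factorials
j(j-1)...(j-k) the operator K is triangular, with diagonal entries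
(-1)^(k+1) k! theta / (theta)_(k+1); these are its eigenvalues and the largest
one is 1/(theta+1).  Hence B <= D/(theta+1), which gives the constant
theta (1 + 1/(theta+1)) = theta (theta+2)/(theta+1). *)

Require Import Defs.
From HB Require Import structures.
From mathcomp Require Import all_boot all_order all_algebra.
From mathcomp Require Import all_classical all_reals all_analysis.
From mathcomp Require Import measurable_realfun.
From mathcomp Require Import ring lra zify.

Set Implicit Arguments.
Unset Strict Implicit.
Unset Printing Implicit Defensive.

Import Order.TTheory GRing.Theory Num.Theory.
Import numFieldNormedType.Exports.

Local Open Scope classical_set_scope.
Local Open Scope ring_scope.

(** * Symmetric forms triangular on a flag *)

Lemma orthogonal_projection (R : realFieldType) (V : vectType R)
    (D : V -> V -> R) (X : seq V) (v : V) :
  (forall u w, D u w = D w u) -> (forall w, scalar (D ^~ w)) ->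
  (forall u, D u u = 0 -> u = 0) ->
  exists2 u, u \in <<X>>%VS & forall w, w \in <<X>>%VS -> D (v - u) w = 0.
Proof.
move=> DC Dl Ddef.
have D0 u : D 0 u = 0.
  by have := Dl u 1 0 0; rewrite scaler0 addr0 mul1r; lra.
have DZ c u w : D (c *: u) w = c * D u w.
  by have := Dl w c u 0; rewrite !addr0 D0 addr0.
have DD u1 u2 w : D (u1 + u2) w = D u1 w + D u2 w.
  by have := Dl w 1 u1 u2; rewrite scale1r mul1r.
have DDr u w1 w2 : D u (w1 + w2) = D u w1 + D u w2 by rewrite DC DD !(DC u).
have DZr c u w : D u (c *: w) = c * D u w by rewrite DC DZ DC.
elim: X v => [|p X IHX] v.
  exists 0; first exact: mem0v.
  by move=> w; rewrite span_nil memv0 => /eqP ->; rewrite DC D0.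
have [p' p'X p'orth] := IHX p.
have [u uX uorth] := IHX v.
have [/Ddef/eqP|q_neq0] := eqVneq (D (p - p') (p - p')) 0.
  rewrite subr_eq0 => /eqP pE; exists u.
    by rewrite span_cons; apply: (subvP (addvSr _ _)).
  move=> w; rewrite span_cons => /memv_addP[_ /vlineP[c ->] [w' w'X ->]].
  by rewrite uorth// memvD// memvZ// pE.
set q := p - p' in q_neq0 *.
set c := D (v - u) q / D q q.
have qu : u + c *: q \in <<p :: X>>%VS.
  rewrite span_cons -[u + _]addrC.
  rewrite /q scalerBr -addrA; apply: memv_add; first by rewrite memvZ// memv_line.
  by rewrite memvD// memvN memvZ.
exists (u + c *: q) => // w; rewrite span_cons => /memv_addP[_ /vlineP[e ->] [w' w'X ->]].
have -> : e *: p + w' = e *: q + (e *: p' + w').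
  by rewrite /q scalerBr addrA subrK.
have w''X : e *: p' + w' \in <<X>>%VS by rewrite memvD// memvZ.
have -> : v - (u + c *: q) = (v - u) + (- c) *: q by rewrite opprD addrA scaleNr.
rewrite DDr [D _ (e *: q)]DD [D _ (e *: p' + w')]DD !DZ (uorth _ w''X) (p'orth _ w''X) !DZr.
by rewrite mulr0 !addr0 /c; field.
Qed.

(* On the orthogonal complement of the k-th step of the flag in the next one,
   B acts as multiplication by lam k, so B is diagonal in an orthogonal basis
   adapted to the flag. *)
Lemma triangular_form_le (R : realFieldType) (V : vectType R)
    (D B : V -> V -> R) (p : nat -> V) (lam : nat -> R) (M : R) (k : nat) (v : V) :
  (forall u w, D u w = D w u) -> (forall w, scalar (D ^~ w)) ->
  (forall u, 0 <= D u u) -> (forall u, D u u = 0 -> u = 0) ->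
  (forall u w, B u w = B w u) -> (forall w, scalar (B ^~ w)) ->
  (forall i, exists2 s, s \in <<mkseq p i>>%VS &
     forall w, B (p i) w = lam i * D (p i) w + D s w) ->
  (forall i, lam i <= M) ->
  v \in <<mkseq p k>>%VS -> B v v <= M * D v v.
Proof.
move=> DC Dl D_ge0 Ddef BC Bl tri lamM.
have spanS i : <<mkseq p i.+1>>%VS = (<<mkseq p i>> + <[p i]>)%VS.
  by rewrite mkseqS -cats1 span_cat span_seq1.
have lin0 (F : V -> V -> R) u : (forall w, scalar (F ^~ w)) -> F 0 u = 0.
  by move=> Fl; have := Fl u 1 0 0; rewrite scaler0 addr0 mul1r; lra.
have linZ (F : V -> V -> R) c u w : (forall w, scalar (F ^~ w)) ->
    F (c *: u) w = c * F u w.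
  by move=> Fl; have := Fl w c u 0; rewrite !addr0 lin0// addr0.
have linD (F : V -> V -> R) u1 u2 w : (forall w, scalar (F ^~ w)) ->
    F (u1 + u2) w = F u1 w + F u2 w.
  by move=> Fl; have := Fl w 1 u1 u2; rewrite scale1r mul1r.
have quad (F : V -> V -> R) c u w : (forall u w, F u w = F w u) ->
    (forall w, scalar (F ^~ w)) ->
    F (u + c *: w) (u + c *: w) = F u u + 2 * c * F u w + c ^+ 2 * F w w.
  move=> FC Fl; rewrite linD// linZ// ![F _ (u + _)]FC !linD// !linZ// (FC w u).
  by ring.
have stable i u : u \in <<mkseq p i>>%VS ->
    exists2 s, s \in <<mkseq p i>>%VS & forall w, B u w = D s w.
  elim: i u => [|i IHi] u.
    rewrite span_nil memv0 => /eqP ->; exists 0; first exact: mem0v.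
    by move=> w; rewrite !lin0.
  rewrite spanS => /memv_addP[u' /IHi[s' s'i Bu'] [_ /vlineP[c ->] ->]].
  have [s si Bp] := tri i.
  exists ((s' + c *: s) + (c * lam i) *: p i).
    by apply: memv_add; rewrite ?memvD ?memvZ ?memv_line.
  by move=> w; rewrite linD// linZ// Bu' Bp !linD// !linZ//; ring.
elim: k v => [|k IHk] v.
  by rewrite span_nil memv0 => /eqP ->; rewrite !lin0// mulr0.
rewrite spanS => /memv_addP[u uk [_ /vlineP[c ->] ->]].
have [p' p'k orth] := orthogonal_projection (mkseq p k) (p k) DC Dl Ddef.
set q := p k - p' in orth.
have -> : u + c *: p k = (u + c *: p') + c *: q.
  by rewrite /q scalerBr -addrA [c *: p' + _]addrC subrK.
set b := u + c *: p'.
have bk : b \in <<mkseq p k>>%VS by rewrite memvD// memvZ.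
have [s sk Bb] := stable _ _ bk.
have [t tk Bp] := tri k.
have [t' t'k Bp'] := stable _ _ p'k.
have Bbq : B b q = 0 by rewrite Bb DC orth.
have Bqq : B q q = lam k * D q q.
  have pE : p k = q + p' by rewrite subrK.
  have -> : B q q = B (p k) q - B p' q by rewrite pE linD// addrK.
  rewrite Bp Bp' [D t q]DC [D t' q]DC (orth t tk) (orth t' t'k) subr0 addr0.
  by rewrite pE linD// [D p' q]DC (orth p' p'k) addr0.
have Dbq : D b q = 0 by rewrite DC orth.
rewrite (quad B)// (quad D)// Bbq Dbq Bqq.
have := IHk _ bk.
have := ler_wpM2l (sqr_ge0 c) (ler_wpM2r (D_ge0 q) (lamM k)).
lra.
Qed.

(** * The centered form on falling factorials *)

Lemma rising_factorialS (R : realType) (x : R) (m : nat) :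
  rising_factorial x m.+1 = rising_factorial x m * (x + m%:R).
Proof. exact: big_ord_recr. Qed.

Lemma rising_factorial_gt0 (R : realType) (x : R) (m : nat) :
  0 < x -> 0 < rising_factorial x m.
Proof. by move=> x0; apply: prodr_gt0 => i _; rewrite ltr_wpDr. Qed.

Lemma Theta_gt0 (R : realType) (theta : R) (m : nat) :
  0 < theta -> 0 < Theta theta m.
Proof.
by move=> t0; rewrite divr_gt0 ?rising_factorial_gt0// ltr0n fact_gt0.
Qed.

Lemma Theta0 (R : realType) (theta : R) : Theta theta 0 = 1.
Proof. by rewrite /Theta /rising_factorial big_ord0 divr1. Qed.

Lemma ThetaS (R : realType) (theta : R) (m : nat) :
  Theta theta m.+1 = Theta theta m * (theta + m%:R) / m.+1%:R.
Proof.
rewrite /Theta rising_factorialS factS natrM.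
have : m`!%:R != 0 :> R by rewrite pnatr_eq0 -lt0n fact_gt0.
by move=> fm; field; rewrite nat1r pnatr_eq0 fm.
Qed.

Lemma natr_ffactnSr (R : pzRingType) (m k : nat) :
  (m ^_ k.+1)%:R = (m ^_ k)%:R * (m%:R - k%:R) :> R.
Proof.
rewrite ffactnSr natrM; have [km|mk] := leqP k m; first by rewrite natrB.
by rewrite ffact_small// !mul0r.
Qed.

Lemma natr_ffactSS (R : comPzRingType) (m k : nat) :
  (m.+1 ^_ k.+1)%:R = (m ^_ k.+1)%:R + k.+1%:R * (m ^_ k)%:R :> R.
Proof. by rewrite ffactSS natrM natr_ffactnSr -!natr1; ring. Qed.

Lemma sum_ffact_Theta (R : realType) (theta : R) (k m : nat) : 0 < theta ->
  \sum_(i < m) (i ^_ k)%:R * Theta theta (m - i.+1) =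
  k`!%:R * (m ^_ k.+1)%:R * Theta theta m / rising_factorial theta k.+1.
Proof.
move=> t0; elim: m k => [|m IHm] k; first by rewrite big_ord0 mulr0 !mul0r.
have rf_neq0 l : rising_factorial theta l != 0 by rewrite gt_eqF ?rising_factorial_gt0.
rewrite big_ord_recl /= subSS subn0.
have tm : theta + m%:R != 0 by rewrite gt_eqF// ltr_wpDr.
have m1 : m%:R + 1 != 0 :> R by rewrite natr1 pnatr_eq0.
case: k => [|k].
  rewrite (eq_bigr (fun i : 'I_m => (i ^_ 0)%:R * Theta theta (m - i.+1))); last first.
    by move=> i _; rewrite !ffactn0 subSS.
  rewrite IHm !ffactn1 fact0 !mul1r ThetaS /rising_factorial big_ord_recl big_ord0.
  rewrite addr0 mulr1 -!natr1; field.
  by rewrite m1 gt_eqF.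
rewrite ffactnS mul0n mul0r add0r.
under eq_bigr do rewrite subSS natr_ffactSS mulrDl -mulrA.
rewrite big_split /= -mulr_sumr !IHm ffactSS natrM factS natrM.
rewrite ThetaS !(natr_ffactnSr _ m k.+1) !(rising_factorialS _ k.+1) -!natr1.
have tk : theta + k.+1%:R != 0 by rewrite gt_eqF// ltr_wpDr.
have := rf_neq0 k.+1.
rewrite -natr1 in tk * => rf; field.
by rewrite tk rf m1.
Qed.

Definition ffact_row (R : realType) (n k : nat) : 'rV[R]_n :=
  \row_i (i.+1 ^_ k.+1)%:R.

Lemma span_mkseqS (K : fieldType) (V : vectType K) (p : nat -> V) (k : nat) :
  <<mkseq p k.+1>>%VS = (<<mkseq p k>> + <[p k]>)%VS.
Proof. by rewrite mkseqS -cats1 span_cat span_seq1. Qed.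

Lemma memv_span_ffact_row (R : realType) (n : nat) (v : 'rV[R]_n) :
  v \in <<mkseq (@ffact_row R n) n>>%VS.
Proof.
suff: forall m, (m <= n)%N -> exists2 w, w \in <<mkseq (@ffact_row R n) m>>%VS &
    forall i : 'I_n, (i < m)%N -> w 0 i = v 0 i.
  move=> /(_ n (leqnn n))[w wn wv].
  by rewrite (_ : v = w)//; apply/rowP => i; rewrite wv.
elim=> [|m IHm] mn; first by exists 0; rewrite ?mem0v.
have [w wm wv] := IHm (ltnW mn).
pose c := (v 0 (Ordinal mn) - w 0 (Ordinal mn)) / (m.+1`!)%:R.
exists (w + c *: ffact_row R n m).
  by rewrite span_mkseqS memv_add// memvZ// memv_line.
move=> i; rewrite ltnS leq_eqVlt !mxE => /predU1P[im|im].
  rewrite im ffactnn (_ : i = Ordinal mn); last exact: val_inj.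
  rewrite addrC divfK ?subrK// pnatr_eq0 -lt0n fact_gt0//.
by rewrite ffact_small// mulr0 addr0 wv.
Qed.

Lemma ffact_row_reflect (R : realType) (n k : nat) :
  exists2 s, s \in <<mkseq (@ffact_row R n) k>>%VS & forall i : 'I_n,
    ((n - i.+1) ^_ k.+1)%:R - (n ^_ k.+1)%:R =
    (-1) ^+ k.+1 * (i.+1 ^_ k.+1)%:R + s 0 i.
Proof.
have mul_span c l (s : 'rV_n) : s \in <<mkseq (@ffact_row R n) l>>%VS ->
    \row_i ((c - i.+1%:R) * s 0 i) \in <<mkseq (@ffact_row R n) l.+1>>%VS.
  elim: l s => [|l IHl] s.
    rewrite span_nil memv0 => /eqP ->; rewrite (_ : \row__ _ = 0) ?mem0v//.
    by apply/rowP => i; rewrite !mxE mulr0.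
  rewrite span_mkseqS => /memv_addP[u /IHl ul [_ /vlineP[e ->] ->]].
  rewrite span_mkseqS (_ : \row__ _ = (\row_i ((c - i.+1%:R) * u 0 i) +
      (e * (c - l.+1%:R)) *: ffact_row R n l) + (- e) *: ffact_row R n l.+1).
    rewrite memv_add//; last by rewrite memvZ// memv_line.
    rewrite memvD// span_mkseqS.
    by rewrite -[X in X \in _]add0r memv_add ?mem0v// memvZ// memv_line.
  by apply/rowP => i; rewrite !mxE (natr_ffactnSr _ _ l.+1); ring.
elim: k => [|k [s sk sE]].
  exists 0; first exact: mem0v.
  by move=> i; rewrite !mxE !ffactn1 natrB//; ring.
exists (\row_i ((n%:R - k.+1%:R - i.+1%:R) * s 0 i) +
   ((- (n ^_ k.+1)%:R) *: ffact_row R n 0 +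
    ((-1) ^+ k.+1 * (n%:R - k.+1%:R - k.+1%:R)) *: ffact_row R n k)).
  by rewrite memvD ?mul_span// memvD// memvZ// memv_span// map_f// mem_iota/=.
move=> i; rewrite !mxE (natr_ffactnSr _ (n - _)) (natr_ffactnSr _ n) natrB//.
have /eqP := sE i; rewrite subr_eq => /eqP ->.
by rewrite (natr_ffactnSr _ i.+1 k.+1) ffactn1 !exprS; ring.
Qed.

Definition first_moment (R : realType) (theta : R) (n : nat) (a : 'I_n -> R)
    (m : nat) : R :=
  \sum_(j < n | (j < m)%N) a j * (theta / j.+1%:R) * Theta theta (m - j.+1).

Lemma first_moment_ffact_row (R : realType) (theta : R) (n k m : nat) :
  0 < theta -> (m <= n)%N ->
  first_moment theta (ffact_row R n k 0) m =
  theta * k`!%:R / rising_factorial theta k.+1 * (m ^_ k.+1)%:R * Theta theta m.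
Proof.
move=> t0 mn; rewrite /first_moment.
transitivity (theta * \sum_(i < m) (i ^_ k)%:R * Theta theta (m - i.+1)).
  rewrite mulr_sumr (big_ord_widen n
    (fun i => theta * ((i ^_ k)%:R * Theta theta (m - i.+1))) mn).
  apply: eq_bigr => i _; rewrite mxE ffactSS natrM; field.
  by rewrite nat1r pnatr_eq0.
by rewrite sum_ffact_Theta//; ring.
Qed.

Lemma centered_form_le (R : realType) (theta : R) (n : nat) (a : 'I_n -> R) :
  0 < theta ->
  \sum_(i < n) (first_moment theta a (n - i.+1) -
     first_moment theta a n * Theta theta (n - i.+1) / Theta theta n) *
     (a i / i.+1%:R) <=
  (theta + 1)^-1 * \sum_(i < n) a i ^+ 2 / i.+1%:R * Theta theta (n - i.+1).
Proof.
move=> t0.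
pose w (i : 'I_n) := Theta theta (n - i.+1) / i.+1%:R.
have w_gt0 i : 0 < w i by rewrite divr_gt0 ?Theta_gt0.
pose D (u v : 'rV[R]_n) := \sum_(i < n) w i * (u 0 i * v 0 i).
pose mu (u : 'rV[R]_n) m := first_moment theta (u 0) m.
pose B (u v : 'rV[R]_n) := \sum_(i < n) (mu u (n - i.+1)%N -
  mu u n * Theta theta (n - i.+1) / Theta theta n) * (v 0 i / i.+1%:R).
have mul c u v m : mu (c *: u + v) m = c * mu u m + mu v m.
  rewrite /mu /first_moment mulr_sumr -big_split; apply: eq_bigr => i _ /=.
  by rewrite !mxE; ring.
have DC u v : D u v = D v u by apply: eq_bigr => i _; rewrite [u _ _ * _]mulrC.
have Dl v : scalar (D ^~ v).
  move=> c u1 u2; rewrite /D mulr_sumr -big_split; apply: eq_bigr => i _ /=.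
  by rewrite !mxE; ring.
have D_ge0 u : 0 <= D u u.
  by apply: sumr_ge0 => i _; rewrite mulr_ge0 ?(ltW (w_gt0 i))// -expr2 sqr_ge0.
have Ddef u : D u u = 0 -> u = 0.
  move/eqP; rewrite psumr_eq0; last first.
    by move=> i _; rewrite mulr_ge0 ?(ltW (w_gt0 i))// -expr2 sqr_ge0.
  move=> /allP u0; apply/rowP => i; rewrite mxE; apply/eqP.
  have := u0 i; rewrite mem_index_enum => /(_ isT)/=.
  by rewrite mulf_eq0 gt_eqF//= mulf_eq0 orbb.
have Bl v : scalar (B ^~ v).
  move=> c u1 u2; rewrite /B mulr_sumr -big_split; apply: eq_bigr => i _ /=.
  by rewrite !mul; ring.
have BC u v : B u v = B v u.
  have BE u' v' : B u' v' =
      \sum_(i < n) \sum_(j < n | (j < n - i.+1)%N)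
        theta / (i.+1%:R * j.+1%:R) * (v' 0 i * u' 0 j) *
        Theta theta (n - i.+1 - j.+1) - mu u' n * mu v' n / (theta * Theta theta n).
    rewrite /B; under eq_bigr do rewrite mulrBl.
    rewrite big_split/= sumrN; congr (_ - _).
      apply: eq_bigr => i _; rewrite /mu /first_moment mulr_suml.
      by apply: eq_bigr => j _; field; rewrite !nat1r !pnatr_eq0.
    have -> : mu v' n = \sum_(i < n) v' 0 i * (theta / i.+1%:R) * Theta theta (n - i.+1).
      by apply: eq_bigl => i; rewrite ltn_ord.
    rewrite mulr_sumr mulr_suml; apply: eq_bigr => i _; field.
    by rewrite !gt_eqF// ?Theta_gt0// nat1r.
  rewrite !BE [mu u n * _]mulrC; congr (_ - _).
  rewrite (exchange_big_dep xpredT)//=; apply: eq_bigr => i _.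
  apply: eq_big => [j|j _]; first by apply/idP/idP; lia.
  rewrite [(n - j.+1 - _)%N]subnAC; congr (_ * _).
  by rewrite [i.+1%:R * _]mulrC [v _ _ * _]mulrC.
pose lam k : R := (-1) ^+ k.+1 * (theta * k`!%:R / rising_factorial theta k.+1).
have lam_le k : lam k <= (theta + 1)^-1.
  have abs_le l : theta * l.+1`!%:R / rising_factorial theta l.+2 <= (theta + 1)^-1.
    elim: l => [|l IHl].
      rewrite /rising_factorial !big_ord_recr big_ord0 /= mul1r addr0 mulr1.
      by rewrite invfM mulrA divff ?mul1r// gt_eqF.
    apply: le_trans IHl; rewrite rising_factorialS factS natrM.
    rewrite invfM [l.+2%:R * _]mulrC !mulrA -mulrA mulrACA ler_piMr//.
    - by rewrite mulr_ge0 ?invr_ge0 ?mulr_ge0 ?ler0n// ltW// rising_factorial_gt0.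
    - by rewrite ler_pdivrMr ?ltr_wpDr// mul1r lerDr ltW.
  have ge0 : 0 <= theta * k`!%:R / rising_factorial theta k.+1.
    by rewrite divr_ge0 ?mulr_ge0 ?ler0n// ltW// rising_factorial_gt0.
  have inv_ge0 : 0 <= (theta + 1)^-1 by rewrite invr_ge0 addr_ge0// ltW.
  rewrite /lam -signr_odd; case: k ge0 => [|k] ge0 /=.
    by rewrite mulN1r (le_trans _ inv_ge0)// oppr_le0.
  case: (odd k) => /=; last by rewrite mul1r abs_le.
  by rewrite mulN1r (le_trans _ inv_ge0)// oppr_le0.
have tri k : exists2 s, s \in <<mkseq (@ffact_row R n) k>>%VS &
    forall v, B (ffact_row R n k) v = lam k * D (ffact_row R n k) v + D s v.
  have [s sk sE] := ffact_row_reflect R n k.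
  pose c : R := theta * k`!%:R / rising_factorial theta k.+1.
  exists (c *: s); first by rewrite memvZ.
  move=> v; rewrite /B /D mulr_sumr -big_split; apply: eq_bigr => i _ /=.
  rewrite /mu !first_moment_ffact_row ?leq_subr// -/c.
  have -> : c * (n ^_ k.+1)%:R * Theta theta n * Theta theta (n - i.+1) / Theta theta n
     = c * (n ^_ k.+1)%:R * Theta theta (n - i.+1).
    by field; rewrite gt_eqF ?Theta_gt0.
  rewrite -mulrBl -mulrBr sE !mxE /lam -/c /w; ring.
have := triangular_form_le DC Dl D_ge0 Ddef BC Bl tri lam_le
  (memv_span_ffact_row (\row_i a i)).
have -> : B (\row_i a i) (\row_i a i) = \sum_(i < n) (first_moment theta a (n - i.+1) -
     first_moment theta a n * Theta theta (n - i.+1) / Theta theta n) *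
     (a i / i.+1%:R).
  have muE m : mu (\row_i a i) m = first_moment theta a m.
    by apply: eq_bigr => j _; rewrite mxE.
  by apply: eq_bigr => i _; rewrite !muE mxE.
move=> /le_trans; apply; rewrite le_eqVlt; apply/orP; left; apply/eqP.
by congr (_ * _); apply: eq_bigr => i _; rewrite /w !mxE; ring.
Qed.

(** * Moments over configurations *)

Definition weighted_size (n : nat) (c : 'I_n -> nat) : nat :=
  (\sum_(i < n) i.+1 * c i)%N.

Definition poisson_weight (R : realType) (theta : R) (n : nat)
    (c : 'I_n -> nat) : R :=
  \prod_(i < n) ((theta / i.+1%:R) ^+ c i / (c i)`!%:R).

(* The parts of a configuration of weighted size at most n are bounded by n,
   so the sum of g over all configurations of weighted size m <= n is finite. *)
Definition config_sum (R : realType) (theta : R) (n : nat)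
    (g : ('I_n -> nat) -> R) (m : nat) : R :=
  \sum_(c : {ffun 'I_n -> 'I_n.+1} | weighted_size (fun i => c i) == m)
     g (fun i => c i) * poisson_weight theta (fun i => c i).

Lemma weighted_sizeD1 (n : nat) (c : 'I_n -> nat) (j : 'I_n) :
  weighted_size (fun i => c i + (i == j))%N = (weighted_size c + j.+1)%N.
Proof.
rewrite /weighted_size; under eq_bigr do rewrite mulnDr.
rewrite big_split/=; congr addn.
rewrite (bigD1 j)//= eqxx muln1 big1 ?addn0// => i /negPf ->.
by rewrite muln0.
Qed.

Lemma leq_weighted_size (n : nat) (c : 'I_n -> nat) (j : 'I_n) :
  (j.+1 * c j <= weighted_size c)%N.
Proof. by rewrite /weighted_size (bigD1 j)//= leq_addr. Qed.

Lemma poisson_weightD1 (R : realType) (theta : R) (n : nat) (c : 'I_n -> nat)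
    (j : 'I_n) :
  (c j).+1%:R * poisson_weight theta (fun i => c i + (i == j))%N =
  theta / j.+1%:R * poisson_weight theta c.
Proof.
rewrite /poisson_weight (bigD1 j)//= [in RHS](bigD1 j)//= eqxx addn1 !mulrA.
congr (_ * _); last by apply: eq_bigr => i /negPf ->; rewrite addn0.
rewrite exprS factS natrM; field.
by rewrite !nat1r !pnatr_eq0 -lt0n fact_gt0.
Qed.

Lemma config_sum_mulX (R : realType) (theta : R) (n : nat)
    (g : ('I_n -> nat) -> R) (j : 'I_n) (m : nat) : (m <= n)%N ->
  config_sum theta (fun c => (c j)%:R * g c) m =
  if (j < m)%N then
    theta / j.+1%:R * config_sum theta (fun c => g (fun i => c i + (i == j))%N) (m - j.+1)
  else 0.
Proof.
move=> mn; rewrite /config_sum.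
rewrite (bigID (fun c : {ffun 'I_n -> 'I_n.+1} => c j == 0 :> nat))/= big1 ?add0r; last first.
  by move=> c /andP[_ /eqP ->]; rewrite !mul0r.
pose up (c : {ffun 'I_n -> 'I_n.+1}) := [ffun i => inord (c i + (i == j)) : 'I_n.+1].
pose down (c : {ffun 'I_n -> 'I_n.+1}) := [ffun i => inord (c i - (i == j)) : 'I_n.+1].
have downE c i : down c i = (c i - (i == j))%N :> nat.
  by rewrite ffunE inordK// (leq_ltn_trans (leq_subr _ _)).
rewrite (reindex_onto up down) => [|c /andP[_ cj]]; last first.
  apply/ffunP => i; apply: val_inj; rewrite ffunE /= downE subnK ?inord_val//.
  by case: eqP => // ->; rewrite lt0n.
have upE (c : {ffun 'I_n -> 'I_n.+1}) : (c j < n)%N ->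
    (fun i => up c i : nat) = (fun i => c i + (i == j))%N.
  move=> cj; apply/funext => i; rewrite ffunE inordK//.
  by case: eqP => [->|_]; rewrite ?addn1// addn0.
case: ifPn => jm; last first.
  rewrite big_pred0// => c; apply/negbTE/negP => /andP[/andP[/eqP sz cj] _].
  have := leq_weighted_size (fun i => up c i) j; rewrite sz.
  rewrite -lt0n in cj; move/(leq_trans (leq_pmulr j.+1 cj)).
  by rewrite (negPf jm).
rewrite mulr_sumr; apply: eq_big => [c|c].
  have [cj|cj] := ltnP (c j) n.
    rewrite upE// weighted_sizeD1 -(eqn_add2r j.+1 (weighted_size (fun i => c i))) subnK//.
    case: eqP => //= _; have /(congr1 (@^~ j)) /= -> := upE _ cj.
    rewrite eqxx addn1 /=; apply/eqP/ffunP => i; apply: val_inj.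
    rewrite /= downE; have /(congr1 (@^~ i)) /= -> := upE _ cj.
    by rewrite addnK.
  have cjn : c j = n :> nat by apply/eqP; rewrite eqn_leq cj -ltnS ltn_ord.
  have -> : up c j = 0 :> nat.
    by rewrite ffunE eqxx cjn addn1 /inord val_insubd ltnn.
  rewrite andbF /=; apply/esym/negbTE/negP => /eqP sz.
  have := leq_weighted_size (fun i => c i) j; rewrite sz cjn mulSn.
  by lia.
move=> /andP[/andP[/eqP sz cj0] _].
have cj : (c j < n)%N.
  rewrite ltn_neqAle -ltnS ltn_ord andbT; apply/negP => /eqP cjn.
  by move: cj0; rewrite ffunE eqxx cjn addn1 /inord val_insubd ltnn.
have /(congr1 (@^~ j)) /= -> := upE _ cj.
rewrite upE// eqxx addn1 [_ * g _]mulrC -[LHS]mulrA.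
have /= -> := poisson_weightD1 theta (fun i => c i) j; ring.
Qed.

Lemma config_sum_sum (R : realType) (theta : R) (n : nat) (I : finType)
    (g : I -> ('I_n -> nat) -> R) (m : nat) :
  config_sum theta (fun c => \sum_i g i c) m = \sum_i config_sum theta (g i) m.
Proof.
rewrite exchange_big; apply: eq_bigr => c _ /=.
by rewrite mulr_suml.
Qed.

Lemma config_sumZ (R : realType) (theta : R) (n : nat) (x : R)
    (g : ('I_n -> nat) -> R) (m : nat) :
  config_sum theta (fun c => x * g c) m = x * config_sum theta g m.
Proof. by rewrite mulr_sumr; apply: eq_bigr => c _; rewrite mulrA. Qed.

Lemma config_sumD (R : realType) (theta : R) (n : nat)
    (g h : ('I_n -> nat) -> R) (m : nat) :
  config_sum theta (fun c => g c + h c) m =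
  config_sum theta g m + config_sum theta h m.
Proof. by rewrite -big_split; apply: eq_bigr => c _; rewrite mulrDl. Qed.

Lemma config_sum1 (R : realType) (theta : R) (n m : nat) : 0 < theta ->
  (m <= n)%N -> config_sum theta (fun _ : 'I_n -> nat => 1) m = Theta theta m.
Proof.
move=> t0; elim/ltn_ind: m => m IHm mn.
have [m0|m_gt0] := posnP m.
  rewrite m0 Theta0 /config_sum (big_pred1 [ffun=> ord0]) => [|c].
    rewrite mul1r /poisson_weight big1// => i _.
    by rewrite ffunE expr0 fact0 divr1.
  rewrite /weighted_size sum_nat_eq0; apply/forallP/eqP => [c0|-> i].
apply/ffunP => i; apply: val_inj; have := c0 i.
    by rewrite ffunE muln_eq0 => /eqP.
  by rewrite ffunE muln0.
have m_neq0 : m%:R != 0 :> R by rewrite pnatr_eq0 -lt0n.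
apply: (mulfI m_neq0).
transitivity (config_sum theta (fun c : 'I_n -> nat =>
    \sum_(j < n) (j.+1%:R * ((c j)%:R * 1))) m).
  rewrite /config_sum mulr_sumr; apply: eq_bigr => c /eqP <-.
  rewrite mul1r; congr (_ * _); rewrite natr_sum.
  by apply: eq_bigr => i _; rewrite natrM mulr1.
rewrite config_sum_sum.
transitivity (theta * \sum_(j < m) (j ^_ 0)%:R * Theta theta (m - j.+1)).
  rewrite mulr_sumr (big_ord_widen n
    (fun j => theta * ((j ^_ 0)%:R * Theta theta (m - j.+1))) mn) [RHS]big_mkcond.
  apply: eq_bigr => j _; rewrite config_sumZ config_sum_mulX//.
  case: ifP => jm; last by rewrite mulr0.
  rewrite IHm ?ffactn0; [|lia..].
  by field; rewrite nat1r pnatr_eq0.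
rewrite sum_ffact_Theta// /rising_factorial big_ord1 fact0 ffactn1 addr0.
by field; rewrite gt_eqF.
Qed.

Lemma config_sum_linear (R : realType) (theta : R) (n : nat) (a : 'I_n -> R)
    (m : nat) : 0 < theta -> (m <= n)%N ->
  config_sum theta (fun c => \sum_i a i * (c i)%:R) m = first_moment theta a m.
Proof.
move=> t0 mn; rewrite config_sum_sum /first_moment [RHS]big_mkcond.
apply: eq_bigr => j _.
have := config_sum_mulX theta (fun=> 1) j mn.
rewrite config_sumZ; under [fun c => _]eq_fun do rewrite mulr1.
move=> ->; case: ifP => jm; last by rewrite mulr0.
by rewrite config_sum1 ?mulrA//; lia.
Qed.

Lemma config_sum_linear_sqr (R : realType) (theta : R) (n : nat)
    (a : 'I_n -> R) : 0 < theta ->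
  config_sum theta (fun c => (\sum_i a i * (c i)%:R) ^+ 2) n =
  \sum_(j < n) theta * (a j / j.+1%:R) *
    (first_moment theta a (n - j.+1) + a j * Theta theta (n - j.+1)).
Proof.
move=> t0.
under [fun c => _]eq_fun do rewrite expr2 mulr_suml.
rewrite config_sum_sum; apply: eq_bigr => j _.
under [fun c => _]eq_fun do rewrite -mulrA.
rewrite config_sumZ (config_sum_mulX _ (fun c => \sum_i a i * (c i)%:R))// ltn_ord.
have -> : (fun c : 'I_n -> nat => \sum_i a i * (c i + (i == j))%:R) =
          (fun c => \sum_i a i * (c i)%:R + a j * 1).
  apply/funext => c; under eq_bigr do rewrite natrD mulrDr.
  rewrite big_split /=; congr (_ + _).
  rewrite (bigD1 j)//= eqxx big1 ?addr0// => i /negPf ->.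
  by rewrite mulr0.
rewrite config_sumD config_sumZ config_sum_linear ?config_sum1 ?leq_subr//.
by field; rewrite nat1r pnatr_eq0.
Qed.

Lemma config_variance_le (R : realType) (theta : R) (n : nat) (a : 'I_n -> R) :
  0 < theta ->
  config_sum theta (fun c => (\sum_i a i * (c i)%:R) ^+ 2) n / Theta theta n -
    (config_sum theta (fun c => \sum_i a i * (c i)%:R) n / Theta theta n) ^+ 2 <=
  theta * (theta + 2) / (theta + 1) *
    \sum_(i < n) (a i ^+ 2 / i.+1%:R * (Theta theta (n - i.+1) / Theta theta n)).
Proof.
move=> t0; rewrite config_sum_linear_sqr// config_sum_linear//.
have Tn := Theta_gt0 n t0.
pose D := \sum_(i < n) a i ^+ 2 / i.+1%:R * Theta theta (n - i.+1).
pose mu := first_moment theta a n.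
have muE : mu = theta * \sum_(i < n) Theta theta (n - i.+1) * (a i / i.+1%:R).
  rewrite /mu /first_moment mulr_sumr (eq_bigl xpredT) => [|i]; last by rewrite ltn_ord.
  by apply: eq_bigr => i _; ring.
have := centered_form_le a t0; rewrite -/mu -/D.
set B := (X in X <= _) => B_le.
have -> : \sum_(i < n) (a i ^+ 2 / i.+1%:R * (Theta theta (n - i.+1) / Theta theta n))
   = D / Theta theta n.
  by rewrite mulr_suml; apply: eq_bigr => i _; rewrite mulrA.
have -> : \sum_(j < n) theta * (a j / j.+1%:R) *
    (first_moment theta a (n - j.+1) + a j * Theta theta (n - j.+1)) =
    theta * (B + D) + mu ^+ 2 / Theta theta n.
  rewrite {1}/mu [mu ^+ 2]expr2 {2}muE [theta * \sum_(i < n) _]mulr_sumr.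
  rewrite mulr_sumr mulr_suml -big_split mulr_sumr -big_split /=.
  by apply: eq_bigr => i _; rewrite -/mu; field; rewrite nat1r pnatr_eq0 gt_eqF.
rewrite -/mu.
have -> : (theta * (B + D) + mu ^+ 2 / Theta theta n) / Theta theta n -
   (mu / Theta theta n) ^+ 2 = (theta * (B + D)) / Theta theta n.
  by field; rewrite gt_eqF.
rewrite mulrA ler_pM2r ?invr_gt0//.
have -> : theta * (theta + 2) / (theta + 1) * D = theta * ((theta + 1)^-1 * D + D).
  by field; rewrite gt_eqF// addr_gt0.
by rewrite ler_pM2l// lerD2r.
Qed.

(** * Conditional expectations *)

Definition point_event (T : Type) (n : nat) (xi : 'I_n -> T -> nat)
    (c : 'I_n -> nat) : set T :=
  \bigcap_(i in [set` [set: 'I_n]%SET]) (xi i @^-1` [set c i]).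

Lemma measurable_point_event d (T : measurableType d) (n : nat)
    (xi : 'I_n -> {mfun T >-> nat}) (c : 'I_n -> nat) :
  measurable (point_event xi c).
Proof.
apply: fin_bigcap_measurable => // i _.
by rewrite -[X in measurable X]setTI; exact: measurable_funP.
Qed.

Lemma point_eventP (T : Type) (n : nat) (xi : 'I_n -> T -> nat)
    (c : 'I_n -> nat) (w : T) :
  point_event xi c w <-> forall i, xi i w = c i.
Proof.
split=> [E i|E i _]; last exact: E.
by apply: E; rewrite /= inE.
Qed.

Lemma indic_ell_mul_sum (R : realType) d (T : measurableType d) (n : nat)
    (xi : 'I_n -> {mfun T >-> nat}) (g : ('I_n -> nat) -> R) (w : T) :
  g (fun i => xi i w) * \1_(ell xi @^-1` [set n]) w =
  \sum_(c : {ffun 'I_n -> 'I_n.+1} | weighted_size (fun i => c i) == n)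
     g (fun i => c i) * \1_(point_event xi (fun i => c i)) w.
Proof.
rewrite !indicE; case: (boolP (w \in _)) => [|/negP] ellw; last first.
  rewrite mulr0 big1// => c /eqP sz; rewrite indicE.
  case: (boolP (w \in _)) => [/set_mem/point_eventP wc|_]; last by rewrite mulr0.
  exfalso; apply: ellw; apply/mem_set => /=; rewrite /ell -[RHS]sz.
  by apply: eq_bigr => i _; rewrite wc.
have {}ellw : ell xi w = n by exact: set_mem ellw.
have le_n i : (xi i w <= n)%N.
  rewrite -[leqRHS]ellw (leq_trans _ (leq_weighted_size (fun i => xi i w) i))//.
  by rewrite leq_pmull.
pose c0 : {ffun 'I_n -> 'I_n.+1} := [ffun i => inord (xi i w)].
have c0E : (fun i => c0 i : nat) = (fun i => xi i w).
  by apply/funext => i; rewrite ffunE inordK// ltnS.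
rewrite (bigD1 c0) /=; last by rewrite c0E; apply/eqP.
rewrite c0E indicE mem_set; last exact/point_eventP.
rewrite big1 ?addr0// => c /andP[_ /eqP cc0]; rewrite indicE memNset ?mulr0//.
move=> /point_eventP wc; apply: cc0; apply/ffunP => i; apply: val_inj.
by rewrite /= -wc ffunE inordK// ltnS.
Qed.

Lemma expectation_indic_ell (R : realType) d (T : measurableType d)
    (Q : probability T R) (n : nat) (xi : 'I_n -> {mfun T >-> nat})
    (g : ('I_n -> nat) -> R) :
  ('E_Q[fun w => (g (fun i => xi i w) * \1_(ell xi @^-1` [set n]) w)%R] =
  \sum_(c : {ffun 'I_n -> 'I_n.+1} | weighted_size (fun i => c i) == n)
     (g (fun i => c i))%:E * Q (point_event xi (fun i => c i)))%E.
Proof.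
rewrite unlock.
under eq_integral do rewrite indic_ell_mul_sum -sumEFin.
rewrite integral_sum//; last first.
  move=> c; under eq_fun do rewrite EFinM.
  by apply: integrableZl => //; apply: integrable_indic => //; exact: measurable_point_event.
apply: eq_bigr => c _; under eq_integral do rewrite EFinM.
rewrite integralZl//; last first.
  by apply: integrable_indic => //; exact: measurable_point_event.
by rewrite integral_indic ?setIT//; exact: measurable_point_event.
Qed.

Lemma prob_point_event (R : realType) (theta : R) d (T : measurableType d)
    (P : probability T R) (n : nat) (xi : 'I_n -> {RV P >-> nat})
    (c : 'I_n -> nat) :
  0 < theta -> mutually_independent P xi ->
  (forall i : 'I_n, poisson_distributed P (theta / i.+1%:R) (xi i)) ->
  P (point_event xi c) =
  ((\prod_(i < n) expR (- (theta / i.+1%:R))) * poisson_weight theta c)%:E.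
Proof.
move=> t0 ind pois; rewrite /point_event ind//.
rewrite -big_split -prodEFin (eq_bigl xpredT) => [|i]; last by rewrite inE.
apply: eq_bigr => i _ /=.
have /(congr1 (@^~ [set c i])) := pois i.
rewrite /distribution /pushforward => ->.
have r0 : 0 < theta / i.+1%:R by rewrite divr_gt0.
rewrite /poisson_prob r0 esum_set1 /poisson_pmf ?r0 1?mulrC//.
by rewrite lee_fin !mulr_ge0 ?expR_ge0// exprn_ge0// ltW.
Qed.

Lemma prob_ell (R : realType) (theta : R) d (T : measurableType d)
    (P : probability T R) (n : nat) (xi : 'I_n -> {RV P >-> nat}) :
  0 < theta -> mutually_independent P xi ->
  (forall i : 'I_n, poisson_distributed P (theta / i.+1%:R) (xi i)) ->
  P (ell xi @^-1` [set n]) =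
  ((\prod_(i < n) expR (- (theta / i.+1%:R))) * Theta theta n)%:E.
Proof.
move=> t0 ind pois; rewrite -expectation_indic; last exact: measurable_ell_eq.
have := expectation_indic_ell P xi (fun=> 1).
rewrite (_ : (fun w => _) = \1_(ell xi @^-1` [set n])); last first.
  by apply/funext => w; rewrite mul1r.
move=> ->; rewrite -(config_sum1 t0 (leqnn n)) mulr_sumr -sumEFin.
apply: eq_bigr => c _; rewrite mul1e mul1r.
exact: prob_point_event.
Qed.

Lemma cond_expectation_ell (R : realType) (theta : R) d (T : measurableType d)
    (P : probability T R) (n : nat) (xi : 'I_n -> {RV P >-> nat})
    (g : ('I_n -> nat) -> R) :
  0 < theta -> mutually_independent P xi ->
  (forall i : 'I_n, poisson_distributed P (theta / i.+1%:R) (xi i)) ->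
  measurable_fun setT (fun w => g (fun i => xi i w)) ->
  ('E_(cond_prob P (measurable_ell_eq xi n))[fun w => g (fun i => xi i w)] =
   (config_sum theta g n / Theta theta n)%:E)%E.
Proof.
move=> t0 ind pois mg; set A := ell xi @^-1` [set n]; set Q := cond_prob _ _.
have mA : measurable A by exact: measurable_ell_eq.
pose K : R := \prod_(i < n) expR (- (theta / i.+1%:R)).
have K0 : 0 < K by apply: prodr_gt0 => i _; exact: expR_gt0.
have Tn := Theta_gt0 n t0.
have PA : P A = (K * Theta theta n)%:E by exact: prob_ell.
have PA0 : (0 < P A)%E by rewrite PA lte_fin mulr_gt0.
have QE U : Q U = (P (U `&` A) * (fine (P A))^-1%:E)%E by exact: cond_probE.
transitivity ('E_Q[fun w => (g (fun i => xi i w) * \1_A w)%R])%E.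
  rewrite unlock; apply: ae_eq_integral => //.
  - by apply/measurable_EFinP.
  - apply/measurable_EFinP; apply: measurable_funM => //.
  exists (~` A); split; first exact: measurableC.
    by apply: eq_trans (QE _) _; rewrite setICl measure0 mul0e.
  move=> w /= nw Aw; apply: nw => _; congr EFin.
  by rewrite indicE mem_set// mulr1.
rewrite expectation_indic_ell /config_sum mulr_suml -sumEFin.
apply: eq_bigr => c /eqP sz.
rewrite [Q _](QE _) PA setIidl; last first.
  move=> w /point_eventP wc; rewrite /A /= /ell -[RHS]sz.
  by apply: eq_bigr => i _; rewrite wc.
rewrite (prob_point_event _ t0)// -/K -!EFinM; congr EFin => /=; field.
by rewrite !gt_eqF.
Qed.

Theorem mainTheorem2 (R : realType) (theta : R) (n : nat) (a : 'I_n -> R)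
    (d : measure_display) (T : measurableType d) (P : probability T R)
    (xi : 'I_n -> {RV P >-> nat}) :
  0 < theta -> (2 <= n)%N ->
  mutually_independent P xi ->
  (forall i : 'I_n, poisson_distributed P (theta / i.+1%:R) (xi i)) ->
  ('V_(cond_prob P (measurable_ell_eq xi n))[lin_stat a xi] <=
   (theta * (theta + 2) / (theta + 1) *
    \sum_(i < n) (a i ^+ 2 / i.+1%:R *
                  (Theta theta (n - i.+1) / Theta theta n)))%:E)%E.
Proof.
move=> t0 _ ind pois.
set Q := cond_prob _ _.
pose Y (c : 'I_n -> nat) : R := \sum_i a i * (c i)%:R.
have mY : measurable_fun setT (lin_stat a xi).
  apply: measurable_sum => i; apply: measurable_funM => //.
  exact: (measurableT_comp (f := fun k : nat => k%:R : R)).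
have EY : ('E_Q[lin_stat a xi] = (config_sum theta Y n / Theta theta n)%:E)%E.
  exact: (@cond_expectation_ell _ _ _ _ _ _ _ Y).
set m := config_sum theta Y n / Theta theta n in EY.
have Tn := Theta_gt0 n t0.
rewrite /variance unlock EY /=.
rewrite (_ : (_ * _)%R = (fun w => (Y (fun i => xi i w) - m) ^+ 2)); last first.
  by apply/funext => w; rewrite expr2.
rewrite (@cond_expectation_ell _ theta _ _ _ _ _ (fun c => (Y c - m) ^+ 2))//; last first.
  apply: (measurable_funX 2); apply: measurable_funB => //.
rewrite lee_fin; apply: le_trans (config_variance_le a t0).
rewrite le_eqVlt; apply/orP; left; apply/eqP.
have -> : (fun c => (Y c - m) ^+ 2) =
          (fun c => Y c ^+ 2 + (- (2 * m)) * Y c + m ^+ 2 * 1).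
  by apply/funext => c; ring.
rewrite !config_sumD !config_sumZ config_sum1// -/Y /m; field.
by rewrite gt_eqF.
Qed.
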